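(* Let $T$ be an endofunctor on $\textbf{Fuzzy-Top}$, $\Sigma$ a fuzzy geometric modal signature for $T$, and $\mathcal{B}=(B,\gamma,\mathcal{V}_B)$ a fuzzy geometric model for $T$. Then the union $\mathcal{R}'=\bigcup\{\mathcal{R}:\mathcal{R}\text{ is a }\Sigma\text{-bisimulation from }\mathcal{B}\text{ to }\mathcal{B}\}$ is a $\Sigma$-bisimulation from $\mathcal{B}$ to itself.
   Context: $\textbf{Fuzzy-Top}$: fuzzy topological spaces ($\tau_S$ a family of maps $S\to[0,1]$ containing constants $0,1$, closed under finite pointwise minima and arbitrary suprema) and fuzzy continuous maps. $\mathcal{Q}(S)=\tau_S$, $\mathcal{Q}(f)=f^{-1}:\mu\mapsto\mu\circ f$. An $n$-ary fuzzy-open predicate lifting is a natural transformation $\lambda:\mathcal{Q}^n\to\mathcal{Q}\circ T$ ($\lambda_S(\mu_1\circ f,\dots,\mu_n\circ f)=\lambda_K(\mu_1,\dots,\mu_n)\circ Tf$); $\Sigma$ is a set of these. A fuzzy geometric model is $(B,\gamma,\mathcal{V}_B)$ with $\gamma:B\to TB$ a morphism and $\mathcal{V}_B:\Phi\to\mathcal{Q}(B)$ for a fixed set $\Phi$ of propositional variables. For $\mathcal{R}\subseteq B_1\times B_2$ and fuzzy sets: $\mathcal{R}[\mu](d')=\sup\{\mu(d):d\mathcal{R}d'\}$, $\mathcal{R}^{-1}[\eta](d)=\sup\{\eta(d'):d\mathcal{R}d'\}$. $\mathcal{R}$ is a $\Sigma$-bisimulation between models $(B_1,\gamma_1,\mathcal{V}_{B_1})$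 and $(B_2,\gamma_2,\mathcal{V}_{B_2})$ if for all $(b_1,b_2)\in\mathcal{R}$: (i) $\mathcal{V}_{B_1}(p)(b_1)=\mathcal{V}_{B_2}(p)(b_2)$ for all $p\in\Phi$; (ii) for every $n$-ary $\lambda\in\Sigma$ and $\mu_i\in\mathcal{Q}(B_1)$, $\eta_i\in\mathcal{Q}(B_2)$ with $\mathcal{R}[\mu_i]\le\eta_i$ and $\mathcal{R}^{-1}[\eta_i]\le\mu_i$ ($i=1,\dots,n$), $\lambda_{B_1}(\mu_1,\dots,\mu_n)(\gamma_1(b_1))=\lambda_{B_2}(\eta_1,\dots,\eta_n)(\gamma_2(b_2))$. *)

(* Defs.v *)
From HB Require Import structures.
From mathcomp Require Import all_boot all_order all_algebra.
From mathcomp Require Import mathcomp_extra boolp classical_sets functions.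
From mathcomp Require Import reals interval_inference.

Set Implicit Arguments.
Unset Strict Implicit.
Unset Printing Implicit Defensive.

Import Order.TTheory GRing.Theory Num.Theory.

Local Open Scope classical_set_scope.
Local Open Scope ring_scope.

Definition fuzzy_set (R : realType) (S : Type) := S -> {i01 R}.
Identity Coercion fuzzy_set_fun : fuzzy_set >-> Funclass.

Section Sup01.
Context {R : realType}.
Implicit Types A : set {i01 R}.

Lemma has_ubound_num01 A : has_ubound [set x%:num | x in A].
Proof. by exists 1 => _ [x _ <-]. Qed.

Lemma sup01_ge0 A : 0 <= sup [set x%:num | x in A].
Proof.
have [->|/set0P[x Ax]] := eqVneq A set0; first by rewrite image_set0 sup0.
apply: (@le_trans _ _ x%:num) => //.
by apply: ub_le_sup; [exact: has_ubound_num01|exists x].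
Qed.

Lemma sup01_le1 A : sup [set x%:num | x in A] <= 1.
Proof.
have [->|/set0P[x Ax]] := eqVneq A set0; first by rewrite image_set0 sup0.
by apply: ge_sup; [exists x%:num, x|move=> _ [y _ <-]].
Qed.

(* The supremum in the complete lattice [0, 1]; in particular the supremum of
   the empty set is 0. *)
Definition sup01 A : {i01 R} := Itv01 (sup01_ge0 A) (sup01_le1 A).

Lemma sup01_ubound A : ubound A (sup01 A).
Proof.
move=> x Ax; have: x%:num <= sup [set x%:num | x in A] by
  apply: ub_le_sup; [exact: has_ubound_num01|exists x].
by [].
Qed.

Lemma ge_sup01 A y : ubound A y -> sup01 A <= y.
Proof.
move=> Ay; suff: sup [set x%:num | x in A] <= y%:num by [].
have [->|/set0P[x Ax]] := eqVneq A set0; first by rewrite image_set0 sup0.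
by apply: ge_sup; [exists x%:num, x|move=> _ [z Az <-]; exact: Ay].
Qed.

End Sup01.

Definition fuzzy_sup (R : realType) (S : Type) (F : set (fuzzy_set R S)) :
  fuzzy_set R S := fun s => sup01 [set mu s | mu in F].

Record fuzzyTop (R : realType) := FuzzyTop {
  carrier :> Type;
  fopen : set (fuzzy_set R carrier);
  fopen0 : fopen (fun=> 0%:i01);
  fopen1 : fopen (fun=> 1%:i01);
  fopen_min : forall mu nu, fopen mu -> fopen nu -> fopen (mu \min nu)%O;
  fopen_sup : forall F, F `<=` fopen -> fopen (fuzzy_sup F) }.

Arguments fopen {R} S : rename.

Record fuzzyHom (R : realType) (S K : fuzzyTop R) := FuzzyHom {
  fuzzyHom_fun :> S -> K;
  fuzzyHom_cont : forall mu, fopen K mu -> fopen S (mu \o fuzzyHom_fun) }.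

Lemma fuzzyHom_id_cont (R : realType) (S : fuzzyTop R) (mu : fuzzy_set R S) :
  fopen S mu -> fopen S (mu \o idfun).
Proof. by []. Qed.

Definition fuzzyHom_id (R : realType) (S : fuzzyTop R) : fuzzyHom S S :=
  FuzzyHom (@fuzzyHom_id_cont R S).

Lemma fuzzyHom_comp_cont (R : realType) (S K L : fuzzyTop R)
    (g : fuzzyHom K L) (f : fuzzyHom S K) (mu : fuzzy_set R L) :
  fopen L mu -> fopen S (mu \o (g \o f)).
Proof. by move=> Lmu; exact: (fuzzyHom_cont f (fuzzyHom_cont g Lmu)). Qed.

Definition fuzzyHom_comp (R : realType) (S K L : fuzzyTop R)
    (g : fuzzyHom K L) (f : fuzzyHom S K) : fuzzyHom S L :=
  FuzzyHom (fuzzyHom_comp_cont g f).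

Record fuzzyEndofunctor (R : realType) := FuzzyEndofunctor {
  fobj :> fuzzyTop R -> fuzzyTop R;
  fmap : forall S K : fuzzyTop R, fuzzyHom S K -> fuzzyHom (fobj S) (fobj K);
  fmap_id : forall S : fuzzyTop R, fmap (fuzzyHom_id S) = fuzzyHom_id (fobj S);
  fmap_comp : forall (S K L : fuzzyTop R) (g : fuzzyHom K L) (f : fuzzyHom S K),
    fmap (fuzzyHom_comp g f) = fuzzyHom_comp (fmap g) (fmap f) }.

Arguments fmap {R} T {S K} f : rename.

Record Q (R : realType) (S : fuzzyTop R) := FOpenSet {
  fopen_set :> fuzzy_set R S;
  fopen_setP : fopen S fopen_set }.

Definition Qmap (R : realType) (S K : fuzzyTop R) (f : fuzzyHom S K)
    (mu : Q K) : Q S :=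
  FOpenSet (fuzzyHom_cont f (fopen_setP mu)).

Record predicate_lifting (R : realType) (T : fuzzyEndofunctor R) (n : nat) :=
  PredicateLifting {
    lifting :> forall S : fuzzyTop R, ('I_n -> Q S) -> Q (T S);
    lifting_natural : forall (S K : fuzzyTop R) (f : fuzzyHom S K)
        (mu : 'I_n -> Q K),
      lifting (fun i => Qmap f (mu i)) = Qmap (fmap T f) (lifting mu) }.

Arguments lifting {R T n} l S mu : rename.

(* A set of predicate liftings of arbitrary finite arities, sorted by arity. *)
Definition modal_signature (R : realType) (T : fuzzyEndofunctor R) :=
  forall n : nat, set (predicate_lifting T n).

Record fuzzy_model (R : realType) (T : fuzzyEndofunctor R) (Phi : Type) :=
  FuzzyModel {
    space :> fuzzyTop R;
    coalg : fuzzyHom space (T space);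
    valuation : Phi -> Q space }.

Section Bisimulation.
Context {R : realType}.

Definition rel_image (S1 S2 : Type) (r : set (S1 * S2)) (mu : fuzzy_set R S1) :
    fuzzy_set R S2 :=
  fun d' => sup01 [set mu d | d in [set d | r (d, d')]].

Definition rel_preimage (S1 S2 : Type) (r : set (S1 * S2))
    (eta : fuzzy_set R S2) : fuzzy_set R S1 :=
  fun d => sup01 [set eta d' | d' in [set d' | r (d, d')]].

Definition bisimulation (T : fuzzyEndofunctor R) (Sigma : modal_signature T)
    (Phi : Type) (B1 B2 : fuzzy_model T Phi) (r : set (B1 * B2)) : Prop :=
  forall (b1 : B1) (b2 : B2), r (b1, b2) ->
    (forall p : Phi, valuation B1 p b1 = valuation B2 p b2) /\
    (forall (n : nat) (lambda : predicate_lifting T n), Sigma n lambda ->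
      forall (mu : 'I_n -> Q B1) (eta : 'I_n -> Q B2),
        (forall i, (rel_image r (mu i) <= eta i)%O /\
                   (rel_preimage r (eta i) <= mu i)%O) ->
        lifting lambda B1 mu (coalg B1 b1) =
        lifting lambda B2 eta (coalg B2 b2)).

End Bisimulation.

(* Main.v *)
Require Import Defs.
From mathcomp Require Import all_boot all_order all_algebra.
From mathcomp Require Import boolp classical_sets reals interval_inference.

Import Order.POrderTheory.

Local Open Scope classical_set_scope.

(** A pair in the union lies in some bisimulation [r], which settles the valuations. Images and
    preimages are suprema over related points, hence grow with the relation ([rel_image_subset],
    [rel_preimage_subset]). Bounds on [mu] and [eta] for the union thus hold for [r], whose lifting
    clause gives the equality. *)

Section Monotonicity.
Context {R : realType} {S1 S2 : Type}.
Implicit Types r s : set (S1 * S2).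

(** [sup01] is a true least upper bound in [0, 1], so an empty [A] needs no separate case. *)
Lemma sup01_subset (A A' : set {i01 R}) : A `<=` A' -> (sup01 A <= sup01 A')%O.
Proof. by move=> AA'; apply: ge_sup01 => x /AA'; exact: sup01_ubound. Qed.

Lemma rel_image_subset r s (mu : fuzzy_set R S1) :
  r `<=` s -> (rel_image r mu <= rel_image s mu)%O.
Proof.
move=> rs; apply/lefP => d'.
by apply: sup01_subset; apply: image_subset => d; exact: rs.
Qed.

Lemma rel_preimage_subset r s (eta : fuzzy_set R S2) :
  r `<=` s -> (rel_preimage r eta <= rel_preimage s eta)%O.
Proof.
move=> rs; apply/lefP => d.
by apply: sup01_subset; apply: image_subset => d'; exact: rs.
Qed.

End Monotonicity.

(* Enlarging a relation leaves fewer pairs (mu, eta) to test, so the pairs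
   coherent for the union are coherent for each of its members. *)
Lemma bisimulation_bigcup (R : realType) (T : fuzzyEndofunctor R)
    (Sigma : modal_signature T) (Phi : Type) (B1 B2 : fuzzy_model T Phi)
    (F : set (set (B1 * B2))) :
  (forall r, F r -> bisimulation Sigma r) ->
  bisimulation Sigma (\bigcup_(r in F) r).
Proof.
move=> Fbis b1 b2 [r Fr rb]; have [val_eq lift_eq] := Fbis r Fr b1 b2 rb.
split=> // n lambda Slambda mu eta coh; apply: lift_eq => // i.
(* The family is indexed by its own members, hence [F := id]; [rU] places [r] inside the union. *)
have [im_le pre_le] := coh i; have rU := bigcup_sup (F := id) Fr.
split; first exact: le_trans (rel_image_subset _ _ _ rU) im_le.
exact: le_trans (rel_preimage_subset _ _ _ rU) pre_le.
Qed.

Theorem theorem5p8 (R : realType) (T : fuzzyEndofunctor R)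
    (Sigma : modal_signature T) (Phi : Type) (B : fuzzy_model T Phi) :
  bisimulation Sigma
    (\bigcup_(r in [set r : set (B * B) | bisimulation Sigma r]) r).
Proof. by apply: bisimulation_bigcup. Qed.
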